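(* Let $\alpha>-1$ and $\beta>-1$ be real and let $a_i(\alpha,\beta,x)$, $b_i(\alpha,\beta,x)$, $c_i(\alpha,\beta,x)$ ($i=1,2,3,\ldots$) be the polynomials in $x$ defined in the context. Then: (1) If $\beta\in\{0,1,2,\ldots\}$, then $a_i(\alpha,\beta,x)=0$ for all $i>2\beta+4$, and $$a_{2\beta+4}(\alpha,\beta,x)=-\frac{1}{(\alpha+1)_{\beta+1}}\frac{(x^2-1)^{\beta+2}}{(\beta+2)!}.$$ (2) If $\alpha\in\{0,1,2,\ldots\}$, then $b_i(\alpha,\beta,x)=0$ for all $i>2\alpha+4$, and $$b_{2\alpha+4}(\alpha,\beta,x)=-\frac{1}{(\beta+1)_{\alpha+1}}\frac{(x^2-1)^{\alpha+2}}{(\alpha+2)!}.$$ (3) If $\alpha,\beta\in\{0,1,2,\ldots\}$, then $c_i(\alpha,\beta,x)=0$ for all $i>2\alpha+2\beta+6$, and $$c_{2\alpha+2\beta+6}(\alpha,\beta,x)=-\frac{\alpha+\beta+2}{(\alpha+1)(\beta+1)}\frac{(x^2-1)^{\alpha+\beta+3}}{(\alpha+\beta+1)!\,(\alpha+\beta+3)!}.$$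
   Context: Notation: $(a)_0=1$, $(a)_k=a(a+1)\cdots(a+k-1)$ for $k\ge 1$. ${}_pF_q\left(\left.{a_1,\ldots,a_p\atop b_1,\ldots,b_q}\right|z\right)=\sum_{k\ge 0}\frac{(a_1)_k\cdots(a_p)_k}{(b_1)_k\cdots(b_q)_k}\frac{z^k}{k!}$; with a numerator parameter $-\ell$, $\ell\in\{0,1,2,\ldots\}$, it is a finite sum over $0\le k\le\ell$. For $i=1,2,3,\ldots$ $$a_i(\alpha,\beta,x)=-(\alpha+\beta+2)2^i\sum_{\ell=0}^{i-1}(-1)^{\ell}\frac{(\beta+3)_{i-\ell-1}(-\beta-2)_{i-\ell-1}}{(\alpha+1)_{i-\ell-1}\,(i-\ell)!\,(i-\ell-1)!\,\ell!}\;{}_3F_2\!\left(\left.{-\ell,\ \alpha+\beta+3,\ \beta+i-\ell+2\atop \alpha+i-\ell,\ i-\ell+1}\right|1\right)\left(\frac{x+1}{2}\right)^{\ell+1},$$ $$b_i(\alpha,\beta,x)=(\alpha+\beta+2)(-2)^i\sum_{\ell=0}^{i-1}\frac{(\alpha+3)_{i-\ell-1}(-\alpha-2)_{i-\ell-1}}{(\beta+1)_{i-\ell-1}\,(i-\ell)!\,(i-\ell-1)!\,\ell!}\;{}_3F_2\!\left(\left.{-\ell,\ \alpha+\beta+3,\ \alpha+i-\ell+2\atop \beta+i-\ell,\ i-\ell+1}\right|1\right)\left(\frac{x-1}{2}\right)^{\ell+1}.$$ Further $c_1(\alpha,\beta,x)=0$ and for $i=2,3,4,\ldots$, $c_i(\alpha,\beta,x)=c_i^{(1)}(\alpha,\beta,x)+c_i^{(2)}(\alpha,\beta,x)$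 with $$c_i^{(1)}(\alpha,\beta,x)=-\frac{(\alpha+\beta+2)^2(\alpha+\beta+3)(\alpha+\beta+4)}{(\alpha+1)(\beta+1)\,i}(x^2-1)2^{i-2}\sum_{\ell=0}^{i-2}(-1)^{\ell}\frac{(\beta+3)_{i-\ell-2}(-\alpha-\beta-3)_{i-\ell-2}}{(i-\ell-1)!\,(i-\ell-2)!\,\ell!\,(i-\ell-1)!}$$ $$\times\;{}_4F_3\!\left(\left.{-\ell,\ \alpha+\beta+5,\ \alpha+\beta+4,\ \beta+i-\ell+1\atop \beta+3,\ i-\ell,\ i-\ell}\right|1\right)\left(\frac{x+1}{2}\right)^{\ell+1},$$ $$c_i^{(2)}(\alpha,\beta,x)=\frac{(\alpha+\beta+2)^2(\alpha+\beta+3)(\alpha+\beta+4)}{(\alpha+1)(\beta+1)\,i}(x^2-1)(-2)^{i-2}\sum_{\ell=0}^{i-2}\frac{(\alpha+3)_{i-\ell-2}(-\alpha-\beta-3)_{i-\ell-2}}{(i-\ell-1)!\,(i-\ell-2)!\,\ell!\,(i-\ell-1)!}$$ $$\times\;{}_4F_3\!\left(\left.{-\ell,\ \alpha+\beta+5,\ \alpha+\beta+4,\ \alpha+i-\ell+1\atop \alpha+3,\ i-\ell,\ i-\ell}\right|1\right)\left(\frac{x-1}{2}\right)^{\ell+1}.$$ *)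

(* Defs.v *)
From mathcomp Require Import all_boot all_order all_algebra.
From mathcomp Require Import all_classical reals topology normedtype sequences.

Set Implicit Arguments.
Unset Strict Implicit.
Unset Printing Implicit Defensive.

Import Order.TTheory GRing.Theory Num.Theory.
Import numFieldNormedType.Exports.

Local Open Scope ring_scope.

(** Pochhammer symbol (a)_k = a (a + 1) ... (a + k - 1). *)
Definition poch (R : realType) (a : R) (k : nat) : R :=
  \prod_(j < k) (a + j%:R).

Definition pFq_term (R : realType) (num den : seq R) (z : R) (k : nat) : R :=
  (\prod_(a <- num) poch a k) / (\prod_(b <- den) poch b k) * (z ^+ k / k`!%:R).

(** The value of the hypergeometric series is the limit of its partial sums;
    see [pFq_terminating] for the finite sum obtained when some numerator
    parameter is a nonpositive integer. *)
Definition pFq (R : realType) (num den : seq R) (z : R) : R :=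
  limn (series (pFq_term num den z)).

Lemma poch_opp_nat (R : realType) (l k : nat) :
  (l < k)%N -> poch (- l%:R : R) k = 0.
Proof.
move=> ltlk; rewrite /poch (bigD1 (Ordinal ltlk)) //=.
by rewrite addNr mul0r.
Qed.

Lemma pFq_terminating (R : realType) (num den : seq R) (z : R) (l : nat) :
  - l%:R \in num ->
  pFq num den z = \sum_(k < l.+1) pFq_term num den z k.
Proof.
move=> lnum; apply: cvg_lim => //.
apply: cvg_near_cst; exists l.+1 => // n /= len.
rewrite /series /= (big_cat_nat (n := l.+1)) //= big_mkord.
have tail0 : \sum_(l.+1 <= k < n) pFq_term num den z k = 0.
  rewrite big_nat_cond big1 // => k /andP[/andP[lk _] _].
  by rewrite /pFq_term (big_rem _ lnum) /= poch_opp_nat // !mul0r.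
by rewrite tail0 addr0.
Qed.

(** [a_coef], [b_coef] and [c_coef] are polynomials in x = 'X.
    Natural-number subtractions such as [i - l - 1] are never truncated
    in the summation ranges used. *)
Definition a_coef (R : realType) (i : nat) (alpha beta : R) : {poly R} :=
  (- (alpha + beta + 2) * 2 ^+ i) *:
  \sum_(l < i)
    ((-1) ^+ l
     * (poch (beta + 3) (i - l - 1) * poch (- beta - 2) (i - l - 1)
        / (poch (alpha + 1) (i - l - 1)
           * (i - l)`!%:R * (i - l - 1)`!%:R * l`!%:R))
     * pFq [:: - l%:R; alpha + beta + 3; beta + (i - l)%:R + 2]
           [:: alpha + (i - l)%:R; (i - l)%:R + 1] 1)
    *: (2^-1 *: ('X + 1)) ^+ l.+1.

Definition b_coef (R : realType) (i : nat) (alpha beta : R) : {poly R} :=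
  ((alpha + beta + 2) * (- 2) ^+ i) *:
  \sum_(l < i)
    (poch (alpha + 3) (i - l - 1) * poch (- alpha - 2) (i - l - 1)
       / (poch (beta + 1) (i - l - 1)
          * (i - l)`!%:R * (i - l - 1)`!%:R * l`!%:R)
     * pFq [:: - l%:R; alpha + beta + 3; alpha + (i - l)%:R + 2]
           [:: beta + (i - l)%:R; (i - l)%:R + 1] 1)
    *: (2^-1 *: ('X - 1)) ^+ l.+1.

(** In [c1_coef] and [c2_coef], with i >= 2, the range l = 0, ..., i - 2
    is l < i - 1. *)
Definition c1_coef (R : realType) (i : nat) (alpha beta : R) : {poly R} :=
  (- ((alpha + beta + 2) ^+ 2 * (alpha + beta + 3) * (alpha + beta + 4)
      / ((alpha + 1) * (beta + 1) * i%:R))) *: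
  (('X ^+ 2 - 1) *
   (2 ^+ (i - 2) *:
    \sum_(l < i - 1)
      ((-1) ^+ l
       * (poch (beta + 3) (i - l - 2) * poch (- alpha - beta - 3) (i - l - 2)
          / ((i - l - 1)`!%:R * (i - l - 2)`!%:R * l`!%:R * (i - l - 1)`!%:R))
       * pFq [:: - l%:R; alpha + beta + 5; alpha + beta + 4;
                 beta + (i - l)%:R + 1]
             [:: beta + 3; (i - l)%:R; (i - l)%:R] 1)
      *: (2^-1 *: ('X + 1)) ^+ l.+1)).

Definition c2_coef (R : realType) (i : nat) (alpha beta : R) : {poly R} :=
  ((alpha + beta + 2) ^+ 2 * (alpha + beta + 3) * (alpha + beta + 4)
   / ((alpha + 1) * (beta + 1) * i%:R)) *:
  (('X ^+ 2 - 1) *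
   ((- 2) ^+ (i - 2) *:
    \sum_(l < i - 1)
      (poch (alpha + 3) (i - l - 2) * poch (- alpha - beta - 3) (i - l - 2)
         / ((i - l - 1)`!%:R * (i - l - 2)`!%:R * l`!%:R * (i - l - 1)`!%:R)
       * pFq [:: - l%:R; alpha + beta + 5; alpha + beta + 4;
                 alpha + (i - l)%:R + 1]
             [:: alpha + 3; (i - l)%:R; (i - l)%:R] 1)
      *: (2^-1 *: ('X - 1)) ^+ l.+1)).

Definition c_coef (R : realType) (i : nat) (alpha beta : R) : {poly R} :=
  if (i <= 1)%N then 0 else c1_coef i alpha beta + c2_coef i alpha beta.

(* Main.v *)
Require Import Defs.
From mathcomp Require Import all_boot all_order all_algebra.
From mathcomp Require Import all_classical reals topology normedtype sequences.
From mathcomp Require Import ring lra zify.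

(* Write q for the index of the Pochhammer symbols that multiply the
   hypergeometric value in the coefficient of index l, so that q + l is
   constant in each sum.  For integer parameters the quotients of Pochhammer
   symbols in the k-th term of the hypergeometric sum telescope to a polynomial
   in q + k which splits into linear factors, so the hypergeometric value is an
   l-th finite difference of that polynomial.  It vanishes when l exceeds the
   degree, it is (-1)^l l! times the leading coefficient when l equals the
   degree, and it involves the sum of the roots when l is one less than the
   degree.  The sum over l is then a binomial expansion of a power of
   w (w + 1), where w = - (x + 1) / 2 for a and c^(1) and w = (x - 1) / 2 for
   b and c^(2); in both cases w (w + 1) = (x^2 - 1) / 4.  For
   c, M = alpha + beta + 3: at i = 2 M + 1 both c^(1) and c^(2) are nonzero but
   cancel; at i = 2 M each is (w (w + 1))^(M - 1) times an affine polynomial in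
   w (up to the common factor), and the two affine polynomials add up to a
   constant. *)

Import Order.TTheory GRing.Theory Num.Theory.
Local Open Scope ring_scope.

(** * Pochhammer symbols and terminating hypergeometric series *)

Section Pochhammer.
Context {R : realType}.
Implicit Types (a : R) (k m n : nat).

Lemma pochD a m k : poch a (m + k) = poch a m * poch (a + m%:R) k.
Proof.
rewrite /poch big_split_ord /=; congr (_ * _).
by apply: eq_bigr => j _; rewrite natrD addrA.
Qed.

Lemma pochS a k : poch a k.+1 = poch a k * (a + k%:R).
Proof. by rewrite /poch big_ord_recr. Qed.

Lemma poch_gt0 a k : 0 < a -> 0 < poch a k.
Proof. by move=> a0; apply: prodr_gt0 => j _; apply: ltr_wpDr. Qed.

Lemma poch_swap a m k : poch a m * poch (a + m%:R) k = poch a k * poch (a + k%:R) m.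
Proof. by rewrite -!pochD addnC. Qed.

(** Both cross products equal [poch a (m + k)]. For fixed [m] the right-hand side is a polynomial of
    degree [m] in [k], which is how hypergeometric terms become polynomial. *)
Lemma poch_ratio a b m k : 0 < a -> b = a + m%:R ->
  poch b k / poch a k = poch (a + k%:R) m / poch a m.
Proof.
move=> a0 ->; have k0 := lt0r_neq0 (poch_gt0 a k a0).
have m0 := lt0r_neq0 (poch_gt0 a m a0).
by apply/eqP; rewrite eqr_div // mulrC poch_swap mulrC.
Qed.

Lemma fact_poch n k : n`!%:R * poch n.+1%:R k = (n + k)`!%:R :> R.
Proof.
elim: k => [|k IHk]; first by rewrite /poch big_ord0 mulr1 addn0.
by rewrite pochS mulrA IHk -natrD -natrM addnS factS mulnC addSn.
Qed.

Lemma poch_opp_bin n k : poch (- n%:R : R) k = (-1) ^+ k * 'C(n, k)%:R * k`!%:R.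
Proof.
rewrite -mulrA -natrM bin_ffact; elim: k => [|k IHk].
  by rewrite /poch big_ord0 ffactn0 mulr1.
rewrite pochS IHk ffactnSr exprS; have [lekn|ltnk] := leqP k n.
  by rewrite natrM natrB //; ring.
by rewrite ffact_small // !(mul0n, mul0r, mulr0).
Qed.

(** The [k!] in [poch_opp_bin] cancels that of the series, leaving the alternating binomial weights
    of an l-th difference. *)
Lemma pFq_terminating_bin (num den : seq R) (l : nat) :
  pFq (- l%:R :: num) den 1 = \sum_(k < l.+1) (-1) ^+ k * 'C(l, k)%:R *
    (\prod_(a <- num) poch a k / \prod_(b <- den) poch b k).
Proof.
rewrite (@pFq_terminating _ _ _ _ l) ?mem_head //; apply: eq_bigr => k _.
rewrite /pFq_term big_cons expr1n poch_opp_bin mul1r.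
have k0 : k`!%:R != 0 :> R by rewrite pnatr_eq0 -lt0n fact_gt0.
by rewrite -[RHS](mulfK k0); ring.
Qed.

End Pochhammer.

(** * Finite differences of products of linear factors *)

Section FiniteDifference.
Context {R : realType}.
Implicit Types (c r : R) (rs : seq R) (n : nat).

(** Up to the sign [(-1) ^+ n], this is the n-th forward difference at [c] of the monic polynomial
    with roots [- r]. *)
Definition altprod n c rs : R :=
  \sum_(k < n.+1) (-1) ^+ k * 'C(n, k)%:R * \prod_(r <- rs) (c + k%:R + r).

Lemma altprod_nil n c : altprod n c [::] = (n == 0)%:R.
Proof.
rewrite -[RHS](expr0n R n) -(subrr 1) exprBn; apply: eq_bigr => k _.
by rewrite big_nil !expr1n !mulr1 mulr_natr.
Qed.

Lemma altprod0 c rs : altprod 0 c rs = \prod_(r <- rs) (c + r).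
Proof. by rewrite /altprod big_ord1 bin0 !mul1r addr0. Qed.

(* Discrete Leibniz rule, using [k * 'C(n.+1, k) = n.+1 * 'C(n, k.-1)]. *)
Lemma altprod_cons n c r rs : altprod n.+1 c (r :: rs) =
  (c + r) * altprod n.+1 c rs - n.+1%:R * altprod n (c + 1) rs.
Proof.
transitivity ((c + r) * altprod n.+1 c rs + \sum_(k < n.+2)
   (-1) ^+ k * (k * 'C(n.+1, k))%:R * \prod_(r <- rs) (c + k%:R + r)).
  rewrite /altprod mulr_sumr -big_split; apply: eq_bigr => k _ /=.
  by rewrite big_cons natrM; ring.
congr (_ + _); rewrite big_ord_recl mul0n mulr0 mul0r add0r /altprod.
rewrite mulr_sumr -sumrN; apply: eq_bigr => k _.
rewrite lift0 -mul_bin_diag exprS natrM.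
under eq_bigr do rewrite -natr1 (addrC k%:R) addrA.
ring.
Qed.

(** In [altprod_cons], dropping a factor lowers the order by at most one, so the degree stays below
    the order. *)
Lemma altprod_small n c rs : (size rs < n)%N -> altprod n c rs = 0.
Proof.
elim: rs n c => [|r rs IHrs] [|n] c //= lt_rs; first by rewrite altprod_nil.
by rewrite altprod_cons !IHrs ?(ltnW lt_rs) // !mulr0 subr0.
Qed.

Lemma altprod_size c rs :
  altprod (size rs) c rs = (-1) ^+ size rs * (size rs)`!%:R.
Proof.
elim: rs c => [|r rs IHrs] c; first by rewrite altprod_nil mulr1.
by rewrite /= altprod_cons altprod_small // IHrs factS natrM exprS; ring.
Qed.

(** Only the two leading coefficients contribute: the bracket is the sum of the nodes
    [c, ..., c + n] plus the sum of the shifts, the subleading coefficient. *)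
Lemma altprod_size_pred n c rs : size rs = n.+1 ->
  altprod n c rs = (-1) ^+ n * n`!%:R *
    (n.+1%:R * c + n%:R * n.+1%:R / 2 + \sum_(r <- rs) r).
Proof.
elim: rs n c => [|r rs IHrs] // [|n] c /= [sz_rs].
  case: rs sz_rs IHrs => // _ _.
  by rewrite altprod0 !big_cons !big_nil fact0 expr0 mulr1 !mul0r !mul1r !addr0.
have := altprod_size c rs; rewrite sz_rs => top_rs.
rewrite altprod_cons top_rs IHrs // big_cons factS natrM exprS -!natr1.
by field.
Qed.

Definition arith (a : R) (k : nat) : seq R := [seq a + t%:R | t <- iota 0 k].

Lemma size_arith a k : size (arith a k) = k.
Proof. by rewrite size_map size_iota. Qed.

Lemma prod_arith a k x : \prod_(r <- arith a k) (x + r) = poch (x + a) k.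
Proof.
rewrite big_map /poch -[X in iota 0 X]subn0 big_mkord.
by apply: eq_bigr => t _; rewrite addrA.
Qed.

Lemma sum_arith a k : \sum_(r <- arith a k) r = k%:R * a + k%:R * (k%:R - 1) / 2.
Proof.
rewrite big_map; elim: k => [|k IHk]; first by rewrite big_nil; ring.
rewrite -addn1 iotaD big_cat IHk big_seq1 add0n natrD /=.
by field.
Qed.

End FiniteDifference.

(** * Reversed sums as binomial expansions *)

Section PolynomialSums.
Context {R : realType}.
Implicit Types (w : {poly R}) (g : nat -> R).

(** Substituting [q = d - l - 1] and cutting at the support of [g] makes the range independent of
    [d]. *)
Lemma sum_rev_support g N d w : (N < d)%N -> (forall q, (N < q)%N -> g q = 0) ->
  \sum_(l < d) g (d - l - 1)%N *: w ^+ l.+1 = \sum_(q < N.+1) g q *: w ^+ (d - q).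
Proof.
move=> ltNd g0; rewrite (reindex_inj rev_ord_inj) /=.
rewrite (big_ord_widen d (fun q => g q *: w ^+ (d - q))) // [RHS]big_mkcond /=.
apply: eq_bigr => l _; have ltld := ltn_ord l.
have -> : (d - (d - l.+1) - 1 = l)%N by lia.
have -> : ((d - l.+1).+1 = d - l)%N by lia.
by case: ltnP => // /g0 ->; rewrite scale0r.
Qed.

Lemma sum_bin_rev w N e :
  \sum_(q < N.+1) 'C(N, q)%:R *: w ^+ (N + e - q) = w ^+ e * (w + 1) ^+ N.
Proof.
rewrite exprDn mulr_sumr; apply: eq_bigr => q _.
have leqN : (q <= N)%N by rewrite -ltnS.
by rewrite expr1n mulr1 scaler_nat mulrnAr -exprD addnC addnBA.
Qed.

(** Rests on q C(N+1, q) = (N+1) C(N, q-1); the truncation of [q - 1] at [q = 0] is harmless since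
    that term is zero. *)
Lemma sum_mul_bin_rev w N e :
  \sum_(q < N.+2) (q * 'C(N.+1, q))%:R *: w ^+ (N + e - (q - 1)) =
  N.+1%:R *: (w ^+ e * (w + 1) ^+ N).
Proof.
rewrite big_ord_recl mul0n scale0r add0r -sum_bin_rev scaler_sumr.
apply: eq_bigr => q _; rewrite lift0 -mul_bin_diag natrM scalerA.
by rewrite subSS subn0.
Qed.

Lemma halves : (2^-1)%:P + (2^-1)%:P = 1 :> {poly R}.
Proof. by rewrite -polyCD -[X in X + X]mul1r -splitr. Qed.

Lemma quarterE : (4^-1)%:P = (2^-1)%:P * (2^-1)%:P :> {poly R}.
Proof. by rewrite -polyCM -invfM -natrM. Qed.

Lemma mul_half_XD1 (w := - (2^-1 *: ('X + 1)) : {poly R}) :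
  w * (w + 1) = 4^-1 *: ('X ^+ 2 - 1).
Proof.
(* With 1 written as two halves, the identity holds even when the constant 1/2 is treated as an
   indeterminate. *)
transitivity (w * (w + ((2^-1)%:P + (2^-1)%:P))); first by rewrite halves.
by rewrite /w -!mul_polyC quarterE; ring.
Qed.

Lemma mul_half_XB1 (w := 2^-1 *: ('X - 1) : {poly R}) :
  w * (w + 1) = 4^-1 *: ('X ^+ 2 - 1).
Proof.
transitivity (w * (w + ((2^-1)%:P + (2^-1)%:P))); first by rewrite halves.
by rewrite /w -!mul_polyC quarterE; ring.
Qed.

End PolynomialSums.

(** * The coefficients a and b *)

Section ACoefficients.
Context {R : realType}.

(** Common form of both families: the sign [(-1) ^+ l] of a goes into [w], and b arises by
    exchanging the parameters. *)
Definition a_sum (alpha beta : R) (i : nat) (w : {poly R}) : {poly R} :=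
  \sum_(l < i)
    (poch (beta + 3) (i - l - 1) * poch (- beta - 2) (i - l - 1)
       / (poch (alpha + 1) (i - l - 1)
          * (i - l)`!%:R * (i - l - 1)`!%:R * l`!%:R)
     * pFq [:: - l%:R; alpha + beta + 3; beta + (i - l)%:R + 2]
           [:: alpha + (i - l)%:R; (i - l)%:R + 1] 1)
    *: w ^+ l.+1.

Lemma a_coefE i alpha beta : a_coef i alpha beta =
  ((alpha + beta + 2) * 2 ^+ i) *: a_sum alpha beta i (- (2^-1 *: ('X + 1))).
Proof.
rewrite /a_coef /a_sum mulNr scaleNr -scalerN -sumrN; congr (_ *: _).
apply: eq_bigr => l _; rewrite -mulrA; move: (_ / _ * _) => X.
rewrite [(- _) ^+ _ in RHS]exprNn; move: ((2^-1 *: _) ^+ _) => Y.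
by rewrite -!mul_polyC polyCM rmorphXn rmorphN1 exprS; ring.
Qed.

Lemma b_coefE i alpha beta : b_coef i alpha beta =
  ((alpha + beta + 2) * (- 2) ^+ i) *: a_sum beta alpha i (2^-1 *: ('X - 1)).
Proof. by rewrite /b_coef /a_sum [beta + alpha]addrC. Qed.

(** Two ratios telescope, with offsets [n + 2 - q] and [n + 1]; the bound on [q] makes the first a
    genuine difference. *)
Lemma a_pFq (alpha : R) (n q l : nat) : -1 < alpha -> (q <= n + 2)%N ->
  pFq [:: - l%:R; alpha + n%:R + 3; n%:R + q.+1%:R + 2]
      [:: alpha + q.+1%:R; q.+1%:R + 1] 1 =
  altprod l q%:R (arith (alpha + 1) (n + 2 - q) ++ arith 2 n.+1)
  / (poch (alpha + q.+1%:R) (n + 2 - q) * poch (q.+2%:R : R) n.+1).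
Proof.
move=> alpha_gt leqN; rewrite pFq_terminating_bin mulr_suml.
apply: eq_bigr => k _; rewrite -[RHS]mulrA; congr (_ * _).
rewrite !big_cons !big_nil !mulr1 big_cat /= !prod_arith.
rewrite -mulf_div (@poch_ratio _ (alpha + q.+1%:R) _ (n + 2 - q)); last 2 first.
- by rewrite -natr1; have := ler0n R q; lra.
- by rewrite natrB // natrD -natr1; ring.
rewrite natr1 (@poch_ratio _ q.+2%:R _ n.+1) ?ltr0n //; last first.
  by rewrite -!natr1; ring.
rewrite mulf_div; congr (_ * _ / _); congr poch; rewrite -!natr1; ring.
Qed.

(** The denominators left by telescoping recombine so that [q] enters the prefactor only through a
    signed binomial coefficient. *)
Lemma a_summand (alpha : R) (n q l : nat) : -1 < alpha ->
  poch (n%:R + 3) q * poch (- n%:R - 2) q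
       / (poch (alpha + 1) q * q.+1`!%:R * q`!%:R * l`!%:R)
     * pFq [:: - l%:R; alpha + n%:R + 3; n%:R + q.+1%:R + 2]
           [:: alpha + q.+1%:R; q.+1%:R + 1] 1 =
  (-1) ^+ q * 'C(n + 2, q)%:R / ((n + 2)`!%:R * poch (alpha + 1) (n + 2)) *
  (altprod l q%:R (arith (alpha + 1) (n + 2 - q) ++ arith 2 n.+1) / l`!%:R).
Proof.
move=> alpha_gt.
have -> : - n%:R - 2 = - (n + 2)%:R :> R by rewrite natrD; ring.
(* For [q] above [n + 2] the subtraction [n + 2 - q] truncates, but both sides vanish with the
   binomial. *)
rewrite poch_opp_bin; have [ltNq|leqN] := ltnP (n + 2) q.
  by rewrite bin_small // !(mulr0, mul0r).
rewrite a_pFq //.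
have -> : poch (alpha + 1) (n + 2) =
    poch (alpha + 1) q * poch (alpha + q.+1%:R) (n + 2 - q).
  by rewrite -{1}(subnKC leqN) pochD -addrA nat1r.
have fact0 k : k`!%:R != 0 :> R by rewrite pnatr_eq0 -lt0n fact_gt0.
have -> : poch (n%:R + 3) q = (q.+1)`!%:R * poch q.+2%:R n.+1 / (n + 2)`!%:R :> R.
  have -> : n%:R + 3 = (n + 2).+1%:R :> R.
    by rewrite -[(n + 2).+1]addn1 !natrD; ring.
  apply: (canRL (mulfK (fact0 _))); rewrite mulrC !fact_poch.
  by congr (_`!%:R); lia.
have p1 : poch (alpha + 1) q != 0 by apply: lt0r_neq0 (poch_gt0 _ _ _); lra.
have p2 : poch (alpha + q.+1%:R) (n + 2 - q) != 0.
  by apply: lt0r_neq0 (poch_gt0 _ _ _); rewrite -natr1; have := ler0n R q; lra.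
have p3 : poch (q.+2%:R : R) n.+1 != 0 by apply: lt0r_neq0 (poch_gt0 _ _ _).
move: (fact0 l) (fact0 q) (fact0 q.+1) (fact0 (n + 2)%N) => f1 f2 f3 f4.
by field; rewrite f1 f2 f3 f4 p1 p2 p3.
Qed.

Lemma a_sumE (alpha : R) (n i : nat) (w : {poly R}) : -1 < alpha ->
  a_sum alpha n%:R i w = \sum_(l < i)
   ((-1) ^+ (i - l - 1) * 'C(n + 2, i - l - 1)%:R
     / ((n + 2)`!%:R * poch (alpha + 1) (n + 2)) *
    (altprod l (i - l - 1)%:R
       (arith (alpha + 1) (n + 2 - (i - l - 1)) ++ arith 2 n.+1) / l`!%:R))
   *: w ^+ l.+1.
Proof.
move=> alpha_gt; apply: eq_bigr => l _; congr (_ *: _).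
rewrite -a_summand //; have -> : (i - l = (i - l - 1).+1)%N by have := ltn_ord l; lia.
by rewrite subSS subn0.
Qed.

(** The product has degree [2n + 3 - q], and [l = i - 1 - q] exceeds it. *)
Lemma a_sum_eq0 (alpha : R) (n i : nat) (w : {poly R}) : -1 < alpha -> (2 * n + 4 < i)%N ->
  a_sum alpha n%:R i w = 0.
Proof.
move=> alpha_gt lti; rewrite a_sumE // big1 // => l _; have ltli := ltn_ord l.
have [ltNq|leqN] := ltnP (n + 2) (i - l - 1).
  by rewrite bin_small // !(mulr0, mul0r) scale0r.
rewrite altprod_small ?mul0r ?mulr0 ?scale0r //.
by rewrite size_cat !size_arith; lia.
Qed.

Lemma a_sum_top (alpha : R) (n : nat) (w : {poly R}) : -1 < alpha ->
  a_sum alpha n%:R (2 * n + 4) w =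
  - ((n + 2)`!%:R * poch (alpha + 1) (n + 2))^-1 *: (w * (w + 1)) ^+ (n + 2).
Proof.
move=> alpha_gt; rewrite a_sumE //.
pose g q : R := - ((n + 2)`!%:R * poch (alpha + 1) (n + 2))^-1 * 'C(n + 2, q)%:R.
transitivity (\sum_(l < 2 * n + 4) g (2 * n + 4 - l - 1)%N *: w ^+ l.+1).
  apply: eq_bigr => l _; congr (_ *: _); rewrite /g; have ltl := ltn_ord l.
  set q := (2 * n + 4 - l - 1)%N.
  have [ltNq|leqN] := ltnP (n + 2) q.
    by rewrite bin_small // !(mulr0, mul0r).
  set rs := _ ++ _.
  have sz_rs : size rs = l by rewrite size_cat !size_arith; lia.
  have := altprod_size q%:R rs; rewrite sz_rs => ->.
  rewrite mulfK ?pnatr_eq0 -?lt0n ?fact_gt0 //.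
  transitivity ((-1) ^+ (q + l) *
     ('C(n + 2, q)%:R / ((n + 2)`!%:R * poch (alpha + 1) (n + 2)))).
    by rewrite exprD; ring.
  (* The sign is the same for every [q], because [q + l] is the fixed odd number [2n + 3]. *)
  have -> : (q + l = (2 * n + 2).+1)%N by lia.
  by rewrite exprS mulnC addn2 -[(n * 2).+2]/(n.+1 * 2)%N exprM sqrr_sign; ring.
rewrite (@sum_rev_support _ _ (n + 2)); first last.
- by move=> q ltNq; rewrite /g bin_small // mulr0.
- by lia.
rewrite exprMn -sum_bin_rev scaler_sumr; apply: eq_bigr => q _.
by rewrite scalerA (_ : 2 * n + 4 = n + 2 + (n + 2))%N //; lia.
Qed.

Lemma half_factor_pow (c : R) N : c ^+ 2 = 4 ->
  c ^+ (2 * N) *: (4^-1 *: ('X ^+ 2 - 1) : {poly R}) ^+ N = ('X ^+ 2 - 1) ^+ N.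
Proof.
by move=> c4; rewrite exprM c4 -exprZn scalerA divff ?scale1r // pnatr_eq0.
Qed.

(** Serves a with [c = 2] and b with [c = -2]: only an even power of [c] occurs. *)
Lemma a_top (alpha c : R) (n : nat) (w : {poly R}) : -1 < alpha -> c ^+ 2 = 4 ->
  w * (w + 1) = 4^-1 *: ('X ^+ 2 - 1) ->
  ((alpha + n%:R + 2) * c ^+ (2 * n + 4)) *: a_sum alpha n%:R (2 * n + 4) w =
  - (1 / poch (alpha + 1) n.+1) *:
            ((n + 2)`!%:R^-1 *: ('X ^+ 2 - 1) ^+ (n + 2)).
Proof.
move=> alpha_gt c4 w2; rewrite a_sum_top // w2.
rewrite -(half_factor_pow c) // !scalerA (_ : 2 * (n + 2) = 2 * n + 4)%N; last by lia.
(* The last factor of [poch (alpha + 1) (n + 2)] is [alpha + n + 2], which cancels the prefactor. *)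
congr (_ *: _); rewrite addn2 pochS -addn2.
have fact0 : (n + 2)`!%:R != 0 :> R by rewrite pnatr_eq0 -lt0n fact_gt0.
have p1 : poch (alpha + 1) n.+1 != 0 by apply: lt0r_neq0 (poch_gt0 _ _ _); lra.
have p2 : alpha + 1 + n.+1%:R != 0.
  by apply: lt0r_neq0; rewrite -natr1; have := ler0n R n; lra.
move: p2; rewrite -natr1 => p2.
by field; rewrite p1 p2 -addn2 fact0.
Qed.

End ACoefficients.

(** * The sums behind the coefficients c *)

Section CCoefficients.
Context {R : realType}.

Definition c_sum (alpha beta : R) (i : nat) (w : {poly R}) : {poly R} :=
  \sum_(l < i - 1)
      (poch (beta + 3) (i - l - 2) * poch (- alpha - beta - 3) (i - l - 2)
          / ((i - l - 1)`!%:R * (i - l - 2)`!%:R * l`!%:R * (i - l - 1)`!%:R)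
       * pFq [:: - l%:R; alpha + beta + 5; alpha + beta + 4;
                 beta + (i - l)%:R + 1]
             [:: beta + 3; (i - l)%:R; (i - l)%:R] 1)
      *: w ^+ l.+1.

Definition c_factor (alpha beta : R) : R :=
  (alpha + beta + 2) ^+ 2 * (alpha + beta + 3) * (alpha + beta + 4)
      / ((alpha + 1) * (beta + 1)).

Lemma c1_coefE i alpha beta : c1_coef i alpha beta =
  (c_factor alpha beta / i%:R) *:
    (('X ^+ 2 - 1) * (2 ^+ (i - 2) *: c_sum alpha beta i (- (2^-1 *: ('X + 1))))).
Proof.
rewrite /c1_coef /c_sum scaleNr -scalerN -mulrN -scalerN -sumrN /c_factor.
rewrite -[in RHS]mulrA -invfM.
congr (_ *: (_ * (_ *: _))).
apply: eq_bigr => l _; rewrite -mulrA; move: (_ / _ * _) => X.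
rewrite [(- _) ^+ _ in RHS]exprNn; move: ((2^-1 *: _) ^+ _) => Y.
by rewrite -!mul_polyC polyCM rmorphXn rmorphN1 exprS; ring.
Qed.

Lemma c2_coefE i alpha beta : c2_coef i alpha beta =
  (c_factor alpha beta / i%:R) *:
    (('X ^+ 2 - 1) * ((- 2) ^+ (i - 2) *: c_sum beta alpha i (2^-1 *: ('X - 1)))).
Proof.
rewrite /c2_coef /c_sum /c_factor -[in RHS]mulrA -invfM.
by rewrite [beta + alpha]addrC [- beta - alpha]addrC.
Qed.

(* For [q = m + n + 3], one factor [poch (n%:R + 3) q] of the generic case
   absorbs a denominator [1 / (x + 1)], which splits its range in two. *)
Definition c_shifts (m n q : nat) : seq R :=
  if (q < m + n + 3)%N then
    arith (n%:R + 3 - q%:R) q ++ arith 2 (m + n + 2 - q) ++ arith 2 (m + n + 3 - q)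
  else arith (- m%:R) m.+1 ++ arith 2 n.+1.

Lemma size_c_shifts m n q : (q <= m + n + 3)%N ->
  (size (c_shifts m n q) + q = 2 * (m + n) + 5)%N.
Proof.
by move=> leqM; rewrite /c_shifts; case: ifP => ltqM; rewrite !size_cat !size_arith; lia.
Qed.

(** The generic formula persists at [q = m + n + 3], so later steps need no case distinction. *)
Lemma sum_c_shifts m n q : (q <= m + n + 3)%N ->
  \sum_(r <- c_shifts m n q) r =
  q%:R * (n%:R + 3 - q%:R) + q%:R * (q%:R - 1) / 2 + (m%:R + n%:R + 4 - q%:R) ^+ 2 - 2.
Proof.
move=> leqM; rewrite /c_shifts; case: ltnP => [ltqM|leMq].
  rewrite !big_cat /= !sum_arith !natrB; [|lia..].
  by rewrite !natrD; field.
have -> : q = (m + n + 3)%N by lia.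
by rewrite big_cat /= !sum_arith -!natr1 !natrD; field.
Qed.

Lemma c_ratio m n q k : (q <= m + n + 3)%N ->
  poch (m%:R + n%:R + 5) k * (poch (m%:R + n%:R + 4) k * poch (n%:R + q.+2%:R + 1) k)
  / (poch (n%:R + 3) k * (poch q.+2%:R k * poch q.+2%:R k)) =
  (\prod_(r <- c_shifts m n q) (q%:R + k%:R + r)) *
  (q.+1`!%:R ^+ 2 / (poch (n%:R + 3) q * (m + n + 3)`!%:R * (m + n + 4)`!%:R)).
Proof.
move=> leqM; have fact0 j : j`!%:R != 0 :> R by rewrite pnatr_eq0 -lt0n fact_gt0.
have n3 : 0 < n%:R + 3 :> R by have := ler0n R n; lra.
have p1 j : poch (n%:R + 3 : R) j != 0 by apply: lt0r_neq0 (poch_gt0 _ _ _).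
have p2 j : poch (q.+2%:R : R) j != 0 by apply: lt0r_neq0 (poch_gt0 _ _ _).
have ratio1 : poch (n%:R + q.+2%:R + 1) k / poch (n%:R + 3) k =
   poch (n%:R + 3 + k%:R) q / poch (n%:R + 3) q :> R.
  by apply: poch_ratio => //; rewrite -!natr1; ring.
rewrite (_ : forall a b c d e : R, a * (b * c) / (d * (e * e)) = c / d * (b / e) * (a / e)); last first.
  by move=> a b c d e; rewrite !invfM; ring.
rewrite ratio1 /c_shifts; case: ltnP => [ltqM|leMq].
  rewrite (@poch_ratio _ q.+2%:R (m%:R + n%:R + 4) (m + n + 2 - q)) ?ltr0n //; last first.
    by rewrite natrB; [rewrite !natrD -!natr1; ring|lia].
  rewrite (@poch_ratio _ q.+2%:R (m%:R + n%:R + 5) (m + n + 3 - q)) ?ltr0n //; last first.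
    by rewrite natrB; [rewrite !natrD -!natr1; ring|lia].
  have -> : (m + n + 3)`!%:R = (q.+1)`!%:R * poch q.+2%:R (m + n + 2 - q) :> R.
    by rewrite fact_poch; congr (_`!%:R); lia.
  have -> : (m + n + 4)`!%:R = (q.+1)`!%:R * poch q.+2%:R (m + n + 3 - q) :> R.
    by rewrite fact_poch; congr (_`!%:R); lia.
  rewrite !big_cat /= !prod_arith.
  have -> : q%:R + k%:R + (n%:R + 3 - q%:R) = n%:R + 3 + k%:R :> R by ring.
  have -> : q%:R + k%:R + 2 = q.+2%:R + k%:R :> R by rewrite -!natr1; ring.
  by field; rewrite p1 !p2 fact0.
(* Boundary case: one ratio is 1 and another is (q+1)/(q+k+1), whose denominator is a factor of
   [poch (n%:R + 3 + k%:R) q]. *)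
have eqM : (m + n + 3 = q)%N by lia.
have -> : m%:R + n%:R + 5 = q.+2%:R :> R by rewrite -eqM -!natr1 !natrD; ring.
have -> : m%:R + n%:R + 4 = q.+1%:R :> R by rewrite -eqM -!natr1 !natrD; ring.
have -> : (m + n + 4 = q.+1)%N by lia.
have q1 : q.+1%:R != 0 :> R by rewrite pnatr_eq0.
have qk1 : (q + k).+1%:R != 0 :> R by rewrite pnatr_eq0.
have -> : poch q.+1%:R k / poch q.+2%:R k = q.+1%:R / (q + k).+1%:R :> R.
  apply/eqP; rewrite eqr_div //; apply/eqP.
  have := poch_swap (q.+1%:R : R) 1 k; rewrite /poch !big_ord1 addr0 natr1 => ->.
  by rewrite /= addr0 -natrD addSn.
rewrite divff // eqM factS natrM big_cat /= !prod_arith.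
have -> : poch (n%:R + 3 + k%:R) q = poch (q%:R + k%:R + - m%:R) m.+1 *
   ((q + k).+1%:R * poch (q%:R + k%:R + 2) n.+1) :> R.
  rewrite -{1}eqM (_ : (m + n + 3 = m.+1 + (1 + n.+1))%N); last by lia.
  have -> : n%:R + 3 + k%:R = q%:R + k%:R + - m%:R :> R.
    by rewrite -eqM !natrD; ring.
  rewrite !pochD; congr (_ * (_ * poch _ _)).
    by rewrite /poch big_ord1 addr0 -!natr1 natrD; ring.
  by rewrite -!natr1; ring.
by field; rewrite p1 fact0 nat1r q1 -natrD nat1r qk1.
Qed.

Lemma c_summand m n q l :
  poch (n%:R + 3) q * poch (- m%:R - n%:R - 3) q
          / (q.+1`!%:R * q`!%:R * l`!%:R * q.+1`!%:R)
       * pFq [:: - l%:R; m%:R + n%:R + 5; m%:R + n%:R + 4; n%:R + q.+2%:R + 1]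
             [:: n%:R + 3; q.+2%:R; q.+2%:R] 1 =
  (-1) ^+ q * 'C(m + n + 3, q)%:R / ((m + n + 3)`!%:R * (m + n + 4)`!%:R) *
  (altprod l q%:R (c_shifts m n q) / l`!%:R).
Proof.
have -> : - m%:R - n%:R - 3 = - (m + n + 3)%:R :> R by rewrite !natrD; ring.
rewrite poch_opp_bin; have [ltNq|leqN] := ltnP (m + n + 3) q.
  by rewrite bin_small // !(mulr0, mul0r).
have fact0 k : k`!%:R != 0 :> R by rewrite pnatr_eq0 -lt0n fact_gt0.
have -> : pFq [:: - l%:R; m%:R + n%:R + 5; m%:R + n%:R + 4; n%:R + q.+2%:R + 1]
             [:: n%:R + 3; q.+2%:R; q.+2%:R] 1 =
  altprod l q%:R (c_shifts m n q) *
  (q.+1`!%:R ^+ 2 / (poch (n%:R + 3) q * (m + n + 3)`!%:R * (m + n + 4)`!%:R)).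
  rewrite pFq_terminating_bin mulr_suml; apply: eq_bigr => k _.
  by rewrite -[RHS]mulrA -c_ratio // !big_cons !big_nil !mulr1.
have p1 : poch (n%:R + 3 : R) q != 0.
  by apply: lt0r_neq0 (poch_gt0 _ _ _); have := ler0n R n; lra.
move: (fact0 l) (fact0 q) (fact0 q.+1) (fact0 (m + n + 3)%N) (fact0 (m + n + 4)%N).
by move=> f1 f2 f3 f4 f5; field; rewrite f1 f2 f3 f4 f5 p1.
Qed.

(** The index [i - l - 2] is written [i - 1 - l - 1] to fit [sum_rev_support] with [d = i - 1]. *)
Lemma c_sumE m n i (w : {poly R}) :
  c_sum m%:R n%:R i w = \sum_(l < i - 1)
   ((-1) ^+ (i - 1 - l - 1) * 'C(m + n + 3, i - 1 - l - 1)%:R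
     / ((m + n + 3)`!%:R * (m + n + 4)`!%:R) *
    (altprod l (i - 1 - l - 1)%:R (c_shifts m n (i - 1 - l - 1)) / l`!%:R))
   *: w ^+ l.+1.
Proof.
apply: eq_bigr => l _; congr (_ *: _); rewrite -c_summand; have ltl := ltn_ord l.
have -> : (i - l = (i - 1 - l - 1).+2)%N by lia.
by rewrite !subSS !subn0.
Qed.

(** The degree is [2m + 2n + 5 - q] and [l = i - 2 - q]. At [i = 2m + 2n + 7] order equals degree,
    so this bound is one above that for [c_coef]. *)
Lemma c_sum_eq0 m n i (w : {poly R}) : (2 * m + 2 * n + 7 < i)%N ->
  c_sum m%:R n%:R i w = 0.
Proof.
move=> lti; rewrite c_sumE // big1 // => l _; have ltli := ltn_ord l.
have [ltNq|leqN] := ltnP (m + n + 3) (i - 1 - l - 1).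
  by rewrite bin_small // !(mulr0, mul0r) scale0r.
rewrite altprod_small ?mul0r ?mulr0 ?scale0r //.
by have := size_c_shifts _ _ _ leqN; lia.
Qed.

(** Order equals degree and [q + l] is odd. The value is symmetric in [m] and [n], which prepares
    the cancellation. *)
Lemma c_sum_odd m n (w : {poly R}) :
  c_sum m%:R n%:R (2 * m + 2 * n + 7) w =
  - ((m + n + 3)`!%:R * (m + n + 4)`!%:R)^-1 *: (w * (w + 1)) ^+ (m + n + 3).
Proof.
rewrite c_sumE.
pose g q : R := - ((m + n + 3)`!%:R * (m + n + 4)`!%:R)^-1 * 'C(m + n + 3, q)%:R.
set d := (_ - 1)%N; transitivity (\sum_(l < d) g (d - l - 1)%N *: w ^+ l.+1).
  apply: eq_bigr => l _; congr (_ *: _); rewrite /g; have ltl := ltn_ord l.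
  set q := (d - l - 1)%N.
  have [ltNq|leqN] := ltnP (m + n + 3) q.
    by rewrite bin_small // !(mulr0, mul0r).
  have sz_rs : size (c_shifts m n q) = l by have := size_c_shifts _ _ _ leqN; lia.
  have := altprod_size q%:R (c_shifts m n q); rewrite sz_rs => ->.
  rewrite mulfK ?pnatr_eq0 -?lt0n ?fact_gt0 //.
  transitivity ((-1) ^+ (q + l) *
     ('C(m + n + 3, q)%:R / ((m + n + 3)`!%:R * (m + n + 4)`!%:R)) : R).
    by rewrite exprD; ring.
  have -> : (q + l = ((m + n + 2) * 2).+1)%N by lia.
  by rewrite exprS exprM sqrr_sign; ring.
rewrite (@sum_rev_support _ _ (m + n + 3)); first last.
- by move=> q ltNq; rewrite /g bin_small // mulr0.
- by lia.
rewrite exprMn -sum_bin_rev scaler_sumr; apply: eq_bigr => q _.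
by rewrite scalerA (_ : d = m + n + 3 + (m + n + 3))%N //; lia.
Qed.

Lemma c_sum_top m n (w : {poly R}) (M := m%:R + n%:R + 3 : R) :
  c_sum m%:R n%:R (2 * m + 2 * n + 6) w =
  ((m + n + 3)`!%:R * (m + n + 4)`!%:R)^-1 *: ((w * (w + 1)) ^+ (m + n + 2) *
   ((3 * M ^+ 2 - M) *: (w + 1) + ((n%:R + 1 - 2 * M) * M)%:P)).
Proof.
rewrite c_sumE.
(* By [altprod_size_pred] with degree [l + 1]; the terms quadratic in [q] cancel between nodes and
   shifts, leaving an affine weight. *)
pose g q : R := ((m + n + 3)`!%:R * (m + n + 4)`!%:R)^-1 *
  ('C(m + n + 3, q)%:R * (3 * M ^+ 2 - M + (n%:R + 1 - 2 * M) * q%:R)).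
set d := (_ - 1)%N; transitivity (\sum_(l < d) g (d - l - 1)%N *: w ^+ l.+1).
  apply: eq_bigr => l _; congr (_ *: _); rewrite /g; have ltl := ltn_ord l.
  set q := (d - l - 1)%N.
  have [ltNq|leqN] := ltnP (m + n + 3) q.
    by rewrite bin_small // !(mulr0, mul0r).
  have sz_rs : size (c_shifts m n q) = l.+1 by have := size_c_shifts _ _ _ leqN; lia.
  rewrite (@altprod_size_pred _ l) // sum_c_shifts // .
  have lE : l%:R = 2 * m%:R + 2 * n%:R + 4 - q%:R :> R.
    by rewrite -!natrM -!natrD -natrB; [congr (_%:R)|]; lia.
  transitivity ((-1) ^+ (q + l) *
     ('C(m + n + 3, q)%:R / ((m + n + 3)`!%:R * (m + n + 4)`!%:R)) *
     (3 * M ^+ 2 - M + (n%:R + 1 - 2 * M) * q%:R) * (l`!%:R / l`!%:R) : R).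
    by rewrite exprD -[l.+1%:R]natr1 lE /M; field; rewrite !pnatr_eq0 -!lt0n !fact_gt0.
  have -> : (q + l = (m + n + 2) * 2)%N by lia.
  by rewrite divff ?pnatr_eq0 -?lt0n ?fact_gt0 // exprM sqrr_sign; ring.
rewrite (@sum_rev_support _ _ (m + n + 3)); first last.
- by move=> q ltNq; rewrite /g bin_small // mul0r mulr0.
- by lia.
have ME : M = (m + n + 2).+1%:R by rewrite /M -[(m + n + 2).+1]addn1 !natrD; ring.
have sum1 := sum_bin_rev w (m + n + 3) (m + n + 2).
have := sum_mul_bin_rev w (m + n + 2) (m + n + 2).
rewrite -ME -[(m + n + 2).+1]addnS => sum2.
(* The constant part of the weight sums to w^(M-1) (w+1)^M, the part linear in [q] to M (w
   (w+1))^(M-1). *)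
transitivity (((m + n + 3)`!%:R * (m + n + 4)`!%:R)^-1 *: (
   (3 * M ^+ 2 - M) *: (w ^+ (m + n + 2) * (w + 1) ^+ (m + n + 3)) +
   (n%:R + 1 - 2 * M) *: (M *: (w ^+ (m + n + 2) * (w + 1) ^+ (m + n + 2))))).
  rewrite -sum1 -sum2 !scaler_sumr -big_split scaler_sumr.
  apply: eq_bigr => -[[|q] /= ltq] _; rewrite /g -scalerA; congr (_ *: _).
    by rewrite mul0n scale0r scaler0 addr0 mulr0 addr0 scalerA mulrC; congr (_ *: _ ^+ _); lia.
  rewrite !scalerA (_ : m + n + 2 + (m + n + 2) - (q.+1 - 1) = d - q.+1)%N; last by lia.
  rewrite (_ : m + n + 3 + (m + n + 2) - q.+1 = d - q.+1)%N; last by lia.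
  by rewrite -scalerDl natrM; congr (_ *: _); ring.
congr (_ *: _); rewrite exprMn -(addn1 2) addnA [(w + 1) ^+ (_ + 1)]exprD expr1.
by rewrite -!mul_polyC polyCM; ring.
Qed.

End CCoefficients.

(** * Vanishing and top value of c *)

Section CVanishing.
Context {R : realType}.

Lemma c_coef_eq0 (m n i : nat) : (2 * m + 2 * n + 6 < i)%N ->
  c_coef i (m%:R : R) n%:R = 0.
Proof.
move=> lti; rewrite /c_coef leqNgt (_ : 1 < i)%N; last by lia.
rewrite c1_coefE c2_coefE -scalerDr -mulrDr.
(* At [i = 2m + 2n + 7] the two sums coincide, and [i - 2] is odd, so the powers of 2 and -2 give
   them opposite signs. *)
have [->|neqi] := eqVneq i (2 * m + 2 * n + 7)%N; last first.
  by rewrite !c_sum_eq0 ?scaler0 ?addr0 ?mulr0 ?scaler0 //; lia.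
rewrite c_sum_odd (_ : 2 * m + 2 * n + 7 = 2 * n + 2 * m + 7)%N; last by lia.
rewrite c_sum_odd mul_half_XD1 mul_half_XB1 [(n + m)%N]addnC.
rewrite [in (- 2) ^+ _]exprNn (_ : _ - 2 = (m + n + 2).*2.+1)%N; last by lia.
by rewrite -signr_odd /= odd_double mulN1r [(- _) *: _]scaleNr subrr mulr0 scaler0.
Qed.

Lemma c_coef_top (m n : nat) (alpha := m%:R : R) (beta := n%:R : R) :
  c_coef (2 * m + 2 * n + 6) alpha beta =
          - ((alpha + beta + 2) / ((alpha + 1) * (beta + 1))) *:
            (((m + n + 1)`!%:R * (m + n + 3)`!%:R)^-1 *:
               ('X ^+ 2 - 1) ^+ (m + n + 3)).
Proof.
rewrite /c_coef leqNgt (_ : 1 < _)%N; last by lia.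
rewrite c1_coefE c2_coefE -scalerDr -mulrDr.
rewrite c_sum_top (_ : 2 * m + 2 * n + 6 = 2 * n + 2 * m + 6)%N; last by lia.
rewrite c_sum_top mul_half_XD1 mul_half_XB1 [(n + m)%N]addnC [n%:R + m%:R]addrC.
rewrite (_ : _ - 2 = 2 * (m + n + 2))%N; last by lia.
rewrite (_ : (- 2) ^+ (2 * _) = 2 ^+ (2 * (m + n + 2)) :> R); last first.
  by rewrite !exprM sqrrN.
rewrite -scalerDr -scalerDr -mulrDr scalerA mulrC.
set M : R := m%:R + n%:R + 3.
(* The two values of [w + 1] add up to 1, and 3M^2 - M + (m + n + 2 - 4M) M = -2M since m + n + 2 =
   M - 1. *)
have -> : (3 * M ^+ 2 - M) *: (- (2^-1 *: ('X + 1)) + 1) +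
    ((n%:R + 1 - 2 * M) * M)%:P + ((3 * M ^+ 2 - M) *: (2^-1 *: ('X - 1) + 1) +
    ((m%:R + 1 - 2 * M) * M)%:P) = (- 2 * M)%:P.
  transitivity ((3 * M ^+ 2 - M) *:
      (- (2^-1 *: ('X + 1)) + 1 + (2^-1 *: ('X - 1) + 1)) +
      ((n%:R + 1 - 2 * M) * M + (m%:R + 1 - 2 * M) * M)%:P).
    by rewrite polyCD scalerDr; ring.
  have -> : - (2^-1 *: ('X + 1)) + 1 + (2^-1 *: ('X - 1) + 1) = 1%:P :> {poly R}.
    transitivity (2 - ((2^-1)%:P + (2^-1)%:P) : {poly R}).
      by rewrite -!mul_polyC; ring.
    by rewrite halves polyC1; ring.
  by rewrite -mul_polyC -polyCM -polyCD; congr (_%:P); rewrite /M; ring.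
rewrite [_ * (- 2 * M)%:P]mulrC mul_polyC -[_ * _ *: _]scalerA.
rewrite [2 ^+ _ *: _]scalerA.
rewrite exprZn -!scalerAr !scalerA -exprS -addnS; congr (_ *: _).
(* All factors are now expressed through [M] and [(m + n + 1)!]; the index [i = 2M] cancels [-2M] up
   to sign. *)
have fact0 k : k`!%:R != 0 :> R by rewrite pnatr_eq0 -lt0n fact_gt0.
have f4 : (m + n + 4)`!%:R = (M + 1) * (m + n + 3)`!%:R :> R.
  by rewrite [in LHS]addnS factS natrM -addn1 !natrD.
have f3 : (m + n + 3)`!%:R = M * ((M - 1) * (m + n + 1)`!%:R) :> R.
  rewrite addnS factS addnS factS !natrM -addnS -addnS !natrD /M.
  by congr (_ * (_ * _)); ring.
have iE : (2 * n + 2 * m + 6)%:R = 2 * M :> R by rewrite !(natrD, natrM) /M; ring.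
have m0 := ler0n R m; have n0 := ler0n R n.
have M0 : M != 0 by apply: lt0r_neq0; rewrite /M; lra.
have M1 : M - 1 != 0 by apply: lt0r_neq0; rewrite /M; lra.
have M2 : M + 1 != 0 by apply: lt0r_neq0; rewrite /M; lra.
have a1 : alpha + 1 != 0 by apply: lt0r_neq0; rewrite /alpha; lra.
have b1 : beta + 1 != 0 by apply: lt0r_neq0; rewrite /beta; lra.
have p4 : (4 : R) ^+ (m + n + 2) != 0 by rewrite expf_neq0 // pnatr_eq0.
have cE : c_factor alpha beta =
   (M - 1) ^+ 2 * M * (M + 1) / ((alpha + 1) * (beta + 1)).
  by rewrite /c_factor; congr (_ / _); rewrite /M; ring.
have abE : alpha + beta + 2 = M - 1 by rewrite /M; ring.
rewrite exprM -natrX exprVn iE f4 f3 cE abE.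
by field; rewrite M0 M1 M2 a1 b1 p4 fact0.
Qed.
End CVanishing.

Theorem mainTheorem2 (R : realType) (alpha beta : R)
    (halpha : -1 < alpha) (hbeta : -1 < beta) :
  [/\ forall n : nat, beta = n%:R ->
        (forall i : nat, (2 * n + 4 < i)%N -> a_coef i alpha beta = 0) /\
        a_coef (2 * n + 4) alpha beta =
          - (1 / poch (alpha + 1) n.+1) *:
            ((n + 2)`!%:R^-1 *: ('X ^+ 2 - 1) ^+ (n + 2)),
      forall m : nat, alpha = m%:R ->
        (forall i : nat, (2 * m + 4 < i)%N -> b_coef i alpha beta = 0) /\
        b_coef (2 * m + 4) alpha beta =
          - (1 / poch (beta + 1) m.+1) *:
            ((m + 2)`!%:R^-1 *: ('X ^+ 2 - 1) ^+ (m + 2))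
    & forall m n : nat, alpha = m%:R -> beta = n%:R ->
        (forall i : nat, (2 * m + 2 * n + 6 < i)%N ->
           c_coef i alpha beta = 0) /\
        c_coef (2 * m + 2 * n + 6) alpha beta =
          - ((alpha + beta + 2) / ((alpha + 1) * (beta + 1))) *:
            (((m + n + 1)`!%:R * (m + n + 3)`!%:R)^-1 *:
               ('X ^+ 2 - 1) ^+ (m + n + 3))].
Proof.
have four (c : R) : c = 2 \/ c = - 2 -> c ^+ 2 = 4.
  by case=> ->; rewrite ?sqrrN -natrX.
split=> [n bE|m aE|m n aE bE]; split=> [i lti|].
- by rewrite a_coefE bE a_sum_eq0 // scaler0.
- by rewrite a_coefE bE; apply: a_top; [|apply: four; left|exact: mul_half_XD1].
- by rewrite b_coefE aE a_sum_eq0 // scaler0.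
- rewrite b_coefE aE [m%:R + beta]addrC.
  by apply: a_top; [|apply: four; right|exact: mul_half_XB1].
- by rewrite aE bE c_coef_eq0.
- by rewrite aE bE c_coef_top.
Qed.
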